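(* Let $q\in\mathbb{N}$ with $q\geq 3$ and $n,m\in\mathbb{N}$ with $n,m\geq 2$. Let $J_2\subset\mathbb{R}$ be the attractor of the iterated function system $$\left\{f_1(x)=\frac{x}{q^n},\ f_2(x)=\frac{x+q^n-1}{q^n}\right\}$$ and $J_3\subset\mathbb{R}$ the attractor of $$\left\{g_1(x)=\frac{x}{q^m},\ g_2(x)=\frac{x+q^m-1}{q^m}\right\}.$$ Let $$s=-\sum_{k=1}^{\infty}\frac{1}{q^{mn\cdot k!}}.$$ Then $J_2+s\subset\mathbb{Q}^c$ and $J_3+s\subset\mathbb{Q}^c$, where $A+s=\{x+s:x\in A\}$. *)

(* Defs.v *)
From HB Require Import structures.
From mathcomp Require Export all_boot all_order all_algebra.
From mathcomp Require Export all_classical all_reals all_analysis.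

Export Order.TTheory GRing.Theory Num.Theory.
Export numFieldNormedType.Exports.

#[export] Set Implicit Arguments.
#[export] Unset Strict Implicit.
#[export] Unset Printing Implicit Defensive.

Local Open Scope classical_set_scope.
Local Open Scope ring_scope.

(* By Hutchinson's theorem, a finite family of contractions of R has exactly
   one such set. *)
Definition is_attractor (R : realType) (F : seq (R -> R)) (K : set R) : Prop :=
  [/\ K !=set0, compact K & K = \big[setU/set0]_(f <- F) (f @` K)].

(* Main.v *)
(** Let [J] be the attractor for base [Q] (a power of [q]) and [t = - s], whose
    base-[Q] digits are [1] at the places [M k!] ([M] is [m] for [Q = q ^ n], [n]
    for [Q = q ^ m]) and [0] elsewhere. Suppose
    [x - t = p / D] with [x] in [J]. Multiplying by [Q ^ (M k!)] and subtracting
    integers gives [y] in [J] and a fraction [c / D] in [[-1, 1]] with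
    [y - c / D = t_k], the rescaled tail of [t], which tends to [0]. There are
    finitely many such fractions and [J] is closed, so [c / D] is in [J] for [k]
    large. But [t_k], magnified by a suitable power of [Q], lies strictly between
    [1 / Q] and [1 - 2 / Q], and no difference of two points of [J] does so: [J]
    consists of two pieces of diameter at most [1 / Q] separated by a gap of
    width at least [1 - 2 / Q]. *)
Require Import Defs.
From mathcomp Require Import all_boot all_order all_algebra.
From mathcomp Require Import all_classical all_reals all_analysis.
From mathcomp Require Import zify ring lra.

Local Open Scope classical_set_scope.
Local Open Scope ring_scope.

Definition two_corner_attractor (R : realType) (Q : R) (J : set R) : Prop :=
  is_attractor [:: (fun x : R => x / Q); (fun x : R => (x + Q - 1) / Q)] J.

Lemma two_corner_closed (R : realType) (Q : R) (J : set R) :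
  two_corner_attractor Q J -> closed J.
Proof. by case=> _ cJ _; exact: compact_closed (@Rhausdorff R) cJ. Qed.

Lemma two_corner_expand (R : realType) (Q : R) (J : set R) (x : R) :
  0 < Q -> two_corner_attractor Q J -> J x -> J (Q * x) \/ J (Q * x - (Q - 1)).
Proof.
move=> Q0 [_ _ JE] Jx; have Qn0 : Q != 0 by rewrite gt_eqF.
move: Jx; rewrite {1}JE big_cons big_seq1 => -[] [y Jy <-]; [left|right].
- by rewrite mulrC divfK.
- by rewrite [Q * _]mulrC divfK // (_ : _ - _ = y) //; ring.
Qed.

(* The maps contract about the centre 1/2, so [B := sup |x - 1/2|] over [J]
   satisfies [B <= B / Q + (Q - 1) / (2 Q)], that is [B <= 1/2]. *)
Lemma two_corner_unit_interval (R : realType) (Q : R) (J : set R) (x : R) :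
  1 < Q -> two_corner_attractor Q J -> J x -> 0 <= x <= 1.
Proof.
move=> Q1 HJ Jx; have [_ cJ _] := HJ.
have Q0 : 0 < Q by lra.
pose A : set R := [set `|y - 2^-1| | y in J].
have Aub : has_ubound A.
  have [M [_ HM]] := compact_bounded cJ.
  exists (M + 1 + 2^-1) => _ [y Jy <-].
  have := HM (M + 1) (ltr_pwDr ltr01 (lexx M)) y Jy => /= yM.
  apply: le_trans (ler_normB _ _) _.
  by rewrite [`|2^-1|]ger0_norm ?lerD2r // invr_ge0.
have supA y : J y -> `|y - 2^-1| <= sup A.
  by move=> Jy; apply: sup_upper_bound; [split=> //; exists `|x - 2^-1|; exists x|exists y].
have supA_le : sup A <= sup A / Q + (Q - 1) / (2 * Q).
  apply: ge_sup; first by exists `|x - 2^-1|; exists x.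
  move=> _ [y Jy <-].
  rewrite -(ler_pM2l Q0) (_ : Q * (_ + _) = sup A + (Q - 1) / 2); last first.
    by field; rewrite gt_eqF.
  rewrite -{1}(gtr0_norm Q0) -normrM.
  by case: (two_corner_expand Q0 HJ Jy) => /supA; rewrite !ler_norml; lra.
have : sup A <= 2^-1.
  rewrite -(ler_pM2l Q0) in supA_le.
  move: supA_le; rewrite (_ : Q * (_ + _) = sup A + (Q - 1) / 2); last first.
    by field; rewrite gt_eqF.
  nra.
by have := supA x Jx; rewrite ler_norml; lra.
Qed.

Lemma two_corner_pieces (R : realType) (Q : R) (J : set R) (x : R) :
  1 < Q -> two_corner_attractor Q J -> J x ->
  (J (Q * x) /\ 0 <= Q * x <= 1) \/
  (J (Q * x - (Q - 1)) /\ 0 <= Q * x - (Q - 1) <= 1).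
Proof.
move=> Q1 HJ Jx; have Q0 : 0 < Q by lra.
by case: (two_corner_expand Q0 HJ Jx) => Jy; [left|right]; split=> //;
  exact: two_corner_unit_interval Q1 HJ Jy.
Qed.

(* Close points of [J] lie in the same piece, so expanding magnifies their
   distance by [Q] until it would fall strictly between the diameter [1 / Q] of
   a piece and the width [1 - 2 / Q] of the gap. *)
Lemma two_corner_gap (R : realType) (Q : R) (J : set R) (j : nat) (x y : R) :
  1 < Q -> two_corner_attractor Q J -> J x -> J y ->
  1 < Q ^+ j.+1 * (x - y) -> Q - 2 <= Q ^+ j.+1 * (x - y).
Proof.
move=> Q1 HJ; have Q0 : 0 < Q by lra.
elim: j x y => [|j IHj] x y Jx Jy.
  rewrite expr1 => Qxy.
  by case: (two_corner_pieces Q1 HJ Jx) => -[_ ?];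
     case: (two_corner_pieces Q1 HJ Jy) => -[_ ?]; lra.
move=> Qxy; rewrite leNgt; apply/negP => Qxy_lt.
have Qj : 1 <= Q ^+ j.+1 by rewrite exprn_ege1 // ltW.
have QE : Q ^+ j.+2 * (x - y) = Q ^+ j.+1 * (Q * (x - y)).
  by rewrite exprSr mulrA.
have d0 : 0 < Q * (x - y).
  by rewrite -(pmulr_rgt0 _ (lt_le_trans ltr01 Qj)) -QE; lra.
have d1 : Q * (x - y) < Q - 2.
  by apply: le_lt_trans Qxy_lt; rewrite QE ler_peMl // ltW.
(* By [d0] and [d1], [x] and [y] lie in the same piece, so one branch expands both and the integer
   it subtracts cancels. *)
case: (two_corner_pieces Q1 HJ Jx) => -[Jx' Bx];
  case: (two_corner_pieces Q1 HJ Jy) => -[Jy' By].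
- have := IHj _ _ Jx' Jy'; rewrite -mulrBr -QE; lra.
- lra.
- lra.
- have := IHj _ _ Jx' Jy'.
  rewrite (_ : Q * x - _ - _ = Q * (x - y)); last by ring.
  rewrite -QE; lra.
Qed.

(** Each expansion multiplies by [b] and subtracts a digit, [0] or [b - 1]; [p] is the integer these
    digits form in base [b]. *)
Lemma two_corner_shift (R : realType) (b i : nat) (J : set R) (x : R) :
  (0 < b)%N -> two_corner_attractor b%:R J -> J x ->
  exists p : int, J (b%:R ^+ i * x - p%:~R).
Proof.
move=> b0 HJ Jx; have Q0 : (0 : R) < b%:R by rewrite ltr0n.
elim: i => [|i [p Jp]]; first by exists 0; rewrite expr0 mul1r subr0.
case: (two_corner_expand Q0 HJ Jp) => Jp'.
- exists (b%:Z * p); rewrite [X in J X](_ : _ = b%:R * (b%:R ^+ i * x - p%:~R)) //.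
  by rewrite exprS intrM -pmulrn; ring.
- exists (b%:Z * p + (b%:Z - 1)).
  rewrite [X in J X](_ : _ = b%:R * (b%:R ^+ i * x - p%:~R) - (b%:R - 1)) //.
  by rewrite exprS intrD intrB intrM -pmulrn; ring.
Qed.

Section HalvingSeries.
Variables (R : realType) (a : R^nat).
Hypothesis a_gt0 : forall k, 0 < a k.
Hypothesis a_half : forall k, (0 < k)%N -> 2 * a k.+1 <= a k.

Let S N := \sum_(1 <= k < N) a k.

Lemma halving_sum_le (K N : nat) : (0 < K)%N ->
  \sum_(K <= k < N) a k <= 2 * a K.
Proof.
move=> K0; have [NK|/ltnW KN] := leqP N K.
  by rewrite big_geq // mulr_ge0 // ltW.
(* Strengthened so that the induction telescopes: [a k <= 2 * a k - 2 * a k.+1]. *)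
suff : \sum_(K <= k < N) a k <= 2 * a K - 2 * a N by have := a_gt0 N; lra.
elim: N KN => [|N IHN]; first by rewrite leqn0 => /eqP ->; rewrite big_geq // subrr.
rewrite leq_eqVlt => /predU1P[->|]; first by rewrite big_geq // subrr.
rewrite ltnS => KN; rewrite big_nat_recr //=.
have := IHN KN; have := a_half (leq_trans K0 KN); lra.
Qed.

Lemma halving_series_cvg : cvgn S.
Proof.
apply: nondecreasing_is_cvgn.
  apply/nondecreasing_seqP => -[|N]; first by rewrite /S !big_geq.
  by rewrite /S [leRHS]big_nat_recr //= lerDl ltW.
by exists (2 * a 1) => _ [N _ <-]; exact: halving_sum_le.
Qed.

Lemma halving_tail (K : nat) : (0 < K)%N ->
  a K < limn S - S K <= 2 * a K.
Proof.
move=> K0; apply/andP; split.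
  (* Strict inequalities are lost in the limit, so a second term is kept. *)
  apply: (@lt_le_trans _ _ (a K + a K.+1)); first by rewrite ltrDl.
  rewrite lerBrDl; apply: limr_ge halving_series_cvg _.
  near=> N; rewrite /S (@big_cat_nat _ _ _ K.+2 1 N) //=; last by near: N; exact: nbhs_infty_ge.
  rewrite !big_nat_recr //= addrA lerDl.
  by apply: sumr_ge0 => k _; exact: ltW.
rewrite lerBlDl; apply: limr_le halving_series_cvg _.
near=> N; rewrite /S (@big_cat_nat _ _ _ K 1 N) //=; last by near: N; exact: nbhs_infty_ge.
by rewrite lerD2l halving_sum_le.
Unshelve. all: by end_near. Qed.

End HalvingSeries.

(** Each fraction outside the closed set [J] has a ball missing [J], and only finitely many
    numerators satisfy [|c| <= D], so one radius serves them all. *)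
Lemma closed_fraction_separation (R : realType) (J : set R) (D : nat) :
  closed J -> exists2 e : R, 0 < e &
    forall (c : int) (t : R), `|c| <= D -> `|t| < e ->
      J (c%:~R / D%:R + t) -> J (c%:~R / D%:R).
Proof.
move=> clJ.
have sep (c : int) : \forall t \near (0 : R),
    J (c%:~R / D%:R + t) -> J (c%:~R / D%:R).
  have [Jc|nJc] := pselect (J (c%:~R / D%:R)); first by near=> t.
  have : nbhs (c%:~R / D%:R : R) (~` J).
    by apply: open_nbhs_nbhs; split=> //; exact: closed_openC.
  move=> /nbhs_ballP[e /= e0 He].
  apply/nbhs_ballP; exists e => //= t; rewrite /ball /= sub0r normrN => te Jct.
  exfalso; apply: He Jct.
  by rewrite /ball /= opprD addrA subrr sub0r normrN.
have : \forall t \near (0 : R), forall i : 'I_(2 * D).+1,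
    J ((i%:Z - D%:Z)%:~R / D%:R + t) -> J ((i%:Z - D%:Z)%:~R / D%:R).
  exact: filter_forall (fun i : 'I_(2 * D).+1 => sep (i%:Z - D%:Z)).
move=> /nbhs_ballP[e /= e0 He]; exists e => // c t cD te.
have [i iE] : exists i : 'I_(2 * D).+1, i%:Z - D%:Z = c.
  have lt : (`|(c + D%:Z)%R| < (2 * D).+1)%N by lia.
  by exists (Ordinal lt) => /=; lia.
by rewrite -iE; apply: He; rewrite /ball /= sub0r normrN.
Unshelve. all: by end_near. Qed.


Lemma two_corner_translate_irrational (R : realType) (b m : nat) (J : set R)
    (x : R) :
  (5 <= b)%N -> (0 < m)%N -> two_corner_attractor b%:R J -> J x ->
  ~ rational (x - \big[+%R/0]_(1 <= k <oo) (1 / b%:R ^+ (m * k`!) : R)).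
Proof.
move=> b5 m0 HJ Jx [r _ rE].
pose Q : R := b%:R; pose a k : R := 1 / Q ^+ (m * k`!).
have Q5 : 5 <= Q by rewrite /Q (ler_nat R 5).
have Q1 : 1 < Q by lra.
have Q0 : 0 < Q by lra.
have Qn0 : Q != 0 by rewrite gt_eqF.
(* Consecutive exponents differ by [m * k * k!], which is at least [k]. *)
have fact_gap k : (0 < k)%N -> (m * k`! + k <= m * k.+1`!)%N.
  move=> k0; rewrite factS mulSn mulnDr leq_add2l mulnCA leq_pmulr //.
  by rewrite muln_gt0 m0 fact_gt0.
have a_gt0 k : 0 < a k by rewrite divr_gt0 // exprn_gt0.
have Qk k : (0 < k)%N -> Q^-1 ^+ k <= 5^-1.
  move=> k0; apply: (@le_trans _ _ (Q^-1 ^+ 1)).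
    by rewrite ler_wiXn2l ?invr_ge0 ?invf_le1 // ltW.
  by rewrite expr1 lef_pV2 // posrE.
have a_decay k : (0 < k)%N -> a k.+1 <= a k * Q^-1 ^+ k.
  move=> k0; rewrite /a !div1r -!exprVn -exprD.
  by rewrite ler_wiXn2l ?invr_ge0 ?invf_le1 ?fact_gap // ltW.
have a_half k : (0 < k)%N -> 2 * a k.+1 <= a k.
  by move=> k0; have := a_decay k k0; have := Qk k k0; have := a_gt0 k; nra.
set L : R := limn _ in rE.
have tail k : (0 < k)%N -> _ := @halving_tail R a a_gt0 a_half k.
pose D := `|denq r|%N.
have D0 : (0 : R) < D%:R by rewrite ltr0n absz_gt0 denq_neq0.
have [e e0 sep] := closed_fraction_separation D (two_corner_closed HJ).
have [k k0 ke] : exists2 k, (0 < k)%N & 2 * Q^-1 ^+ k < e.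
  have : `|Q^-1| < 1 by rewrite gtr0_norm ?invr_gt0 // invf_lt1.
  have e2 : 0 < e / 2 by rewrite divr_gt0.
  move=> /cvg_expr /cvgr0_norm_lt /(_ _ e2) ev.
  near \oo => k; exists k; first by near: k; exact: nbhs_infty_gt.
  rewrite mulrC -ltr_pdivlMr //; apply: le_lt_trans (ler_norm _) _.
  by near: k.
pose i := (m * k`!)%N; pose T := L - \sum_(1 <= l < k.+1) a l.
have /andP[T_gt T_le] : a k.+1 < T <= 2 * a k.+1 by exact: tail.
have [p1 Jy] := two_corner_shift i (ltnW (ltnW (ltnW (ltnW b5)))) HJ Jx.
(* [Q ^+ i] clears the denominators of the first [k] terms. *)
have [p2 p2E] : exists p : int, Q ^+ i * \sum_(1 <= l < k.+1) a l = p%:~R.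
  exists (\sum_(1 <= l < k.+1) b ^ (i - m * l`!))%N.
  rewrite -pmulrn natr_sum mulr_sumr; apply: eq_big_nat => l /andP[l1 lk].
  have li : (m * l`! <= i)%N by rewrite leq_mul2l leq_fact ?orbT.
  rewrite /a div1r natrX -[in LHS](subnK li) exprD mulfK //.
  by rewrite expf_neq0.
have Qi0 : 0 < Q ^+ i by exact: exprn_gt0.
have t_gt0 : 0 < Q ^+ i * T.
  by rewrite mulr_gt0 //; apply: lt_trans T_gt.
have t_le : Q ^+ i * T <= 2 * Q^-1 ^+ k.
  apply: le_trans (_ : Q ^+ i * (2 * (a k * Q^-1 ^+ k)) <= _).
    by rewrite ler_pM2l //; apply: le_trans T_le _; rewrite ler_pM2l ?a_decay.
  by rewrite /a div1r mulrCA mulVKf // gt_eqF.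
have t_le1 : Q ^+ i * T <= 1.
  by apply: le_trans t_le _; have := Qk k k0; lra.
(* Since [x = r + L], this is the numerator over [D] of [Q ^+ i * r + p2 - p1]. *)
pose c : int := b%:Z ^+ i * numq r + (p2 - p1) * D%:Z.
have cE : c%:~R / D%:R = Q ^+ i * x - p1%:~R - Q ^+ i * T.
  have DE : D%:R = (denq r)%:~R :> R by rewrite pmulrn absz_denq.
  rewrite /c /T mulrBr p2E intrD intrM rmorphXn /= intrM intrB -!pmulrn.
  have -> : Q ^+ i * x = Q ^+ i * (ratr r + L) by rewrite rE subrK.
  by rewrite /ratr -DE -/Q; field; rewrite gt_eqF.
have /andP[y0 y1] := two_corner_unit_interval Q1 HJ Jy.
have Jc : J (c%:~R / D%:R).
  apply: (sep c (Q ^+ i * T)).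
  - have : `|c%:~R / D%:R : R| <= 1 by rewrite cE ler_norml; lra.
    rewrite normrM normfV (gtr0_norm D0) ler_pdivrMr // mul1r.
    by rewrite -intr_norm pmulrn ler_int.
  - by rewrite gtr0_norm //; exact: le_lt_trans ke.
  - by rewrite cE subrK.
have ik : (i < m * k.+1`!)%N 
  by apply: leq_trans (fact_gap k k0); rewrite -addn1 leq_add2l.
(* Magnifying by [Q ^+ j.+1] brings the leading term of the tail to [1]. *)
pose j := (m * k.+1`! - i).-1.
have jE : Q ^+ j.+1 * (Q ^+ i * T) = T / a k.+1.
  rewrite mulrA -exprD /j prednK ?subn_gt0 // subnK; last exact: ltnW.
  by rewrite /a div1r invrK mulrC.
(* The ratio [T / a k.+1] exceeds [1], so it would be at least [Q - 2 >= 3], but the tail bound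
   makes it at most [2]. *)
have := two_corner_gap (j := j) Q1 HJ Jy Jc.
rewrite cE opprB addrC subrK jE ltr_pdivlMr // mul1r => /(_ T_gt).
rewrite ler_pdivlMr // => T_ge.
have := a_gt0 k.+1; nra.
Unshelve. all: by end_near. Qed.

Theorem theorem1p9 (R : realType) (q n m : nat)
    (hq : (3 <= q)%N) (hn : (2 <= n)%N) (hm : (2 <= m)%N)
    (J2 J3 : set R)
    (hJ2 : is_attractor [:: (fun x : R => x / q%:R ^+ n);
                            (fun x : R => (x + q%:R ^+ n - 1) / q%:R ^+ n)] J2)
    (hJ3 : is_attractor [:: (fun x : R => x / q%:R ^+ m);
                            (fun x : R => (x + q%:R ^+ m - 1) / q%:R ^+ m)] J3)
    (s : R)
    (hs : s = - (\big[+%R/0]_(1 <= k <oo) (1 / q%:R ^+ (m * n * k`!) : R))) :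
  [set x + s | x in J2] `<=` ~` (@rational R) /\
  [set x + s | x in J3] `<=` ~` (@rational R).
Proof.
have q_exp l : (2 <= l)%N -> (5 <= q ^ l)%N.
  move=> l2; apply: (@leq_trans (3 ^ 2)) => //.
  apply: (@leq_trans (3 ^ l)); first by rewrite leq_exp2l.
  by rewrite leq_exp2r // ltnW.
split=> _ [x Jx <-]; rewrite hs.
(* The factor [n] of the exponent goes into the base; for [J3] it is [m]. *)
- rewrite [X in limn X](_ : _ = fun N => \sum_(1 <= k < N) 1 / (q ^ n)%:R ^+ (m * k`!)).
    apply: two_corner_translate_irrational (q_exp n hn) (ltnW hm) _ Jx.
    by rewrite /two_corner_attractor natrX.
  apply/funext => N; apply: eq_bigr => k _.
  by rewrite natrX -exprM mulnCA mulnA.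
- rewrite [X in limn X](_ : _ = fun N => \sum_(1 <= k < N) 1 / (q ^ m)%:R ^+ (n * k`!)).
    apply: two_corner_translate_irrational (q_exp m hm) (ltnW hn) _ Jx.
    by rewrite /two_corner_attractor natrX.
  apply/funext => N; apply: eq_bigr => k _.
  by rewrite natrX -exprM mulnA.
Qed.
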